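(* Let $G$ be a countably infinite cancellative semigroup. The set of disjunctive elements of $\{0,1\}^G$ is comeager in $\{0,1\}^G$.
   Context: The space $\{0,1\}^G$ of functions $G\to\{0,1\}$ carries the product topology (each factor discrete). A subset is comeager if its complement is a countable union of nowhere dense sets. For finite disjoint $L_1,L_2\subseteq G$, let $V(L_1,L_2)=\{\alpha\in\{0,1\}^G: \alpha(x)=1 \text{ for all } x\in L_1 \text{ and } \alpha(x)=0\text{ for all }x\in L_2\}$. An element $\alpha\in\{0,1\}^G$ is disjunctive if for every pair $(L_1,L_2)$ of finite disjoint subsets of $G$ there is some $g\in G$ with $\alpha\in V(L_1g,L_2g)$, where $L_ig=\{xg:x\in L_i\}$. *)

(* Defs.v *)
From mathcomp Require Import all_boot.
From mathcomp Require Import boolp classical_sets functions cardinality topology.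

Set Implicit Arguments.
Unset Strict Implicit.
Unset Printing Implicit Defensive.

Local Open Scope classical_set_scope.

(* Two-sided cancellation: [y * x = z * x -> y = z] and [x * y = x * z -> y = z].
   The [choiceType] structure contained in [semigroupType] is no restriction:
   classically every type carries one. *)
Definition cancellative (G : semigroupType) : Prop :=
  left_injective (@mul G) /\ right_injective (@mul G).

Definition countably_infinite (T : Type) : Prop :=
  countable [set: T] /\ infinite_set [set: T].

Definition nowhere_dense (T : topologicalType) (A : set T) : Prop :=
  interior (closure A) = set0.

(* Since [set0] is nowhere dense, sequences also cover finite unions. *)
Definition comeager (T : topologicalType) (A : set T) : Prop :=
  exists F : nat -> set T,
    (forall n, nowhere_dense (F n)) /\ ~` A = \bigcup_n F n.

(* [{ptws G -> bool}] is the product of copies of [bool], whose canonical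
   topology is discrete; [true] and [false] stand for 1 and 0. *)
Definition V (G : Type) (L1 L2 : set G) : set {ptws G -> bool} :=
  [set alpha | (forall x, L1 x -> alpha x = true) /\
               (forall x, L2 x -> alpha x = false)].

Definition rtranslate (G : semigroupType) (L : set G) (g : G) : set G :=
  [set (x * g)%g | x in L].

Definition disjunctive (G : semigroupType) (alpha : {ptws G -> bool}) : Prop :=
  forall L1 L2 : set G, finite_set L1 -> finite_set L2 -> L1 `&` L2 = set0 ->
    exists g : G, V (rtranslate L1 g) (rtranslate L2 g) alpha.

(* Main.v *)
Require Import Defs.
From mathcomp Require Import finmap all_boot.
From mathcomp Require Import boolp classical_sets functions cardinality topology.

Local Open Scope classical_set_scope.

(** Baire category argument. For fixed finite disjoint [L1] and [L2], let
    [missing L1 L2] be the set of those [alpha] that lie in no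
    [V (L1 g) (L2 g)]. An element fails to be disjunctive exactly when it
    belongs to some [missing L1 L2], and a countable [G] has only countably
    many pairs of finite subsets, so it suffices that each [missing L1 L2] is
    nowhere dense.

    A neighborhood of [alpha] constrains only the coordinates in some finite
    set [K] ([nbhs_ptws_boolP]). By left cancellation, each equation
    [x * g = k] with [x] in [L1 `|` L2] and [k] in [K] has at most one
    solution [g]; hence, [G] being infinite, some translate of [L1 `|` L2]
    by [g] misses [K] ([exists_disjoint_translate]). By right cancellation
    [L1 g] and [L2 g] are disjoint, so [alpha] can be redefined off [K] so as
    to lie in [V (L1 g) (L2 g)]. The new point is in the given neighborhood of
    [alpha], but not in the closure of [missing L1 L2], since
    [V (L1 g) (L2 g)] is open and disjoint from [missing L1 L2]. *)

(** The basic neighborhoods of the product topology over a discrete factor.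
    For the direct implication, the sets containing all points that agree with
    [alpha] on some finite set form a filter; it converges to [alpha]
    coordinatewise, hence in the product. *)
Lemma nbhs_ptws_boolP {T : choiceType} (alpha : {ptws T -> bool})
    (U : set {ptws T -> bool}) :
  nbhs alpha U <->
  exists2 K : set T, finite_set K &
    forall beta : {ptws T -> bool}, {in K, beta =1 alpha} -> U beta.
Proof.
split=> [alphaU|[K finK]].
- pose F := [set W : set {ptws T -> bool} | exists2 K : set T, finite_set K &
    forall beta : {ptws T -> bool}, {in K, beta =1 alpha} -> W beta].
  have FF : Filter F.
    split=> [|A B [K finK KA] [K' finK' KB]|A B AB [K finK KA]].
    + by exists set0.
    + exists (K `|` K'); first by rewrite finite_setU.
      move=> beta eqb; split; [apply: KA | apply: KB] => x Kx; apply: eqb;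
        by rewrite in_setU Kx ?orbT.
    + by exists K => // beta /KA/AB.
  suff : {ptws, F --> alpha} by apply.
  (* The criterion wants a topology on the index set, which the product
     ignores; the discrete one will do. *)
  apply/(@pointwise_cvgP (discrete_topology T)) => t.
  move=> W /principal_filterP Wt.
  exists [set t]; first exact: finite_set1.
  by move=> beta eqb /=; rewrite /= eqb // inE.
- case/finite_fsetP: finK => X ->{K} KU.
  have : nbhs alpha
      (\bigcap_(x in [set` X]) [set beta : {ptws T -> bool} | beta x = alpha x]).
    apply: filter_bigI => x _.
    exact: (@proj_continuous T (fun=> bool) x alpha _ (discrete_set1 _)).
  apply: filterS => beta eqb; apply: KU => x; rewrite inE; exact: eqb.
Qed.

(** Each equation [x * g = k] with [x] in [L] and [k] in [K] determines [g]. *)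
Lemma finite_meeting_translate {G : semigroupType} (L K : set G) :
    right_injective (@mul G) -> finite_set L -> finite_set K ->
  finite_set [set g | rtranslate L g `&` K !=set0].
Proof.
move=> injM finL finK.
apply: (@sub_finite_set _ _ (\bigcup_(x in L) (mul x @^-1` K))).
  by move=> g [_ [[x Lx <-] Kxg]]; exists x.
apply: bigcup_finite => // x _.
by apply: finite_preimage => // g h _ _; apply: injM.
Qed.

Lemma exists_disjoint_translate {G : semigroupType} (L K : set G) :
    infinite_set [set: G] -> right_injective (@mul G) ->
    finite_set L -> finite_set K ->
  exists g, rtranslate L g `&` K = set0.
Proof.
move=> infG injM finL finK.
have /(infinite_setD infG)/infinite_setN0[g [_ /set0P/negP]] :=
  finite_meeting_translate _ _ injM finL finK.
by rewrite negbK => /eqP; exists g.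
Qed.

Definition missing {G : semigroupType} (L1 L2 : set G) :
    set {ptws G -> bool} :=
  [set alpha | forall g, ~ V (rtranslate L1 g) (rtranslate L2 g) alpha].

Lemma nbhs_V {T : choiceType} (L1 L2 : set T) (alpha : {ptws T -> bool}) :
    finite_set L1 -> finite_set L2 -> V L1 L2 alpha ->
  nbhs alpha (V L1 L2).
Proof.
move=> fin1 fin2 [a1 a2]; apply/nbhs_ptws_boolP.
exists (L1 `|` L2); first by rewrite finite_setU.
move=> beta eqb; split=> x Lx; rewrite eqb ?inE; [exact: a1|by left| |by right].
exact: a2.
Qed.

Lemma nowhere_dense_missing {G : semigroupType} (L1 L2 : set G) :
    infinite_set [set: G] -> cancellative G ->
    finite_set L1 -> finite_set L2 -> L1 `&` L2 = set0 ->
  nowhere_dense (missing L1 L2).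
Proof.
move=> infG [injr injl] fin1 fin2 L12; rewrite /nowhere_dense -subset0.
move=> alpha /nbhs_ptws_boolP[K finK KU].
have [|g gK] := exists_disjoint_translate (L1 `|` L2) _ infG injl _ finK.
  by rewrite finite_setU.
have offK x y : (L1 `|` L2) x -> K y -> (x * g)%g <> y.
  move=> Lx Ky xgy; have : (rtranslate (L1 `|` L2) g `&` K) y.
    by split=> //; exists x.
  by rewrite gK.
pose beta : {ptws G -> bool} := fun y =>
  if y \in K then alpha y else y \in rtranslate L1 g.
have Vbeta : V (rtranslate L1 g) (rtranslate L2 g) beta.
  split=> _ [x Lx <-]; rewrite /beta ifF.
  - by apply: mem_set; exists x.
  - by apply/negP; rewrite inE => /offK; apply=> //; left.
  - apply/negP; rewrite inE => -[x' L1x' /injr x'x].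
    by have : (L1 `&` L2) x by [split=> //; rewrite -x'x]; rewrite L12.
  - by apply/negP; rewrite inE => /offK; apply=> //; right.
have : closure (missing L1 L2) beta.
  by apply: KU => y Ky; rewrite /beta Ky.
have finM L : finite_set L -> finite_set (rtranslate L g).
  exact: finite_image.
by case/(_ _ (nbhs_V _ _ _ (finM _ fin1) (finM _ fin2) Vbeta)) => gamma [/(_ g)].
Qed.

(** Transporting along an injection into [nat] reduces the enumeration of pairs
    of finite sets to that of pairs of lists of numbers. Removing the first
    set from the second makes every index denote a disjoint pair, without
    losing any pair that was already disjoint. *)
Lemma enum_disjoint_finite_sets {T : Type} :
    countable [set: T] ->
  exists p : nat -> set T * set T,
    (forall n, [/\ finite_set (p n).1, finite_set (p n).2 &
                   (p n).1 `&` (p n).2 = set0]) /\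
    (forall L1 L2, finite_set L1 -> finite_set L2 -> L1 `&` L2 = set0 ->
       exists n, p n = (L1, L2)).
Proof.
case/countable_injP => f injf.
have finf A : finite_set A -> finite_set (f @^-1` A).
  by apply: finite_preimage => x y _ _; apply: injf; rewrite inE.
have decode L : finite_set L -> exists s : seq nat, f @^-1` [set` s] = L.
  move=> /(finite_image f)/finite_seqP[s fLs]; exists s; rewrite -fLs.
  apply/seteqP; split=> [x [y Ly fyx]|x Lx]; last by exists x.
  by rewrite -(injf _ _ _ _ fyx) ?inE.
pose q n := odflt ([::], [::]) (unpickle n : option (seq nat * seq nat)).
exists (fun n => (f @^-1` [set` (q n).1],
                  f @^-1` [set` (q n).2] `\` f @^-1` [set` (q n).1])).
split=> [n|L1 L2 fin1 fin2 L12] /=.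
- split; [exact/finf/finite_seq | exact/finite_setD/finf/finite_seq |].
  exact: setDIK.
- have [[s1 E1] [s2 E2]] := (decode _ fin1, decode _ fin2).
  exists (pickle (s1, s2)); rewrite /q pickleK /= E1 E2; congr pair.
  by apply/setDidPl; rewrite setIC.
Qed.

Theorem theorem40 (G : semigroupType) (hinf : countably_infinite G)
    (hcanc : cancellative G) :
  comeager [set alpha : {ptws G -> bool} | disjunctive alpha].
Proof.
case: hinf => countG infG.
have [p [pdisj psurj]] := enum_disjoint_finite_sets countG.
exists (fun n => missing (p n).1 (p n).2); split=> [n|].
  by have [fin1 fin2 p12] := pdisj n; apply: nowhere_dense_missing.
apply/seteqP; split=> alpha /=.
- apply: contra_notP => notmissing L1 L2 fin1 fin2 L12.
  have [n pn] := psurj _ _ fin1 fin2 L12.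
  apply: contra_notP notmissing => noV; exists n => // g.
  by rewrite pn => Vg; apply: noV; exists g.
- case=> n _ miss disj; have [fin1 fin2 p12] := pdisj n.
  by have [g /miss] := disj _ _ fin1 fin2 p12.
Qed.
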